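(* Let $K=\mathbb{F}_q$ be a finite field with $q\neq 2$, and let $\mathcal{C}$ be a clutter with vertex set $V_{\mathcal C}$, edge set $E_{\mathcal C}$ and $s$ edges. Let $X$, $Y$, $I(X)\subset S=K[t_1,\ldots,t_s]$ and $I(Y)\subset S[u]=K[t_1,\ldots,t_s,t_{s+1}]$ be as defined in the context. (a) If there is $A\subset V_{\mathcal C}$ such that $|A\cap e|=1$ for every $e\in E_{\mathcal C}$, then $I(Y)=I(X)+(t_1^{q-1}-t_{s+1}^{q-1})$. (b) If $k\geq 2$ is an integer, $\mathcal{C}$ is $k$-uniform (all its edges have cardinality $k$) and $\gcd(q-1,k)=1$, then $I(Y)=I(X)+(t_1^{q-1}-t_{s+1}^{q-1})$. Here $I(X)$ on the right-hand sides denotes its extension $I(X)S[u]$.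
   Context: A clutter $\mathcal{C}$ is a family $E_{\mathcal C}$ of subsets (edges) of a finite vertex set $V_{\mathcal C}=\{y_1,\ldots,y_n\}$ such that no edge is contained in a different edge. Let $f_1,\ldots,f_s$ ($s\geq 1$) be the edges of $\mathcal{C}$ and let $v_i=\sum_{y_j\in f_i}e_j\in\{0,1\}^n$ be the characteristic vector of $f_i$. Put $K^*=K\setminus\{0\}$ and, for $x\in (K^* )^n$, $x^{v_i}=x_1^{v_{i1}}\cdots x_n^{v_{in}}$. Define $X=\{[(x^{v_1},\ldots,x^{v_s})] : x\in (K^* )^n\}\subset\mathbb{P}^{s-1}$ and $Y=\{[(x^{v_1},\ldots,x^{v_s},1)] : x\in (K^* )^n\}\subset\mathbb{P}^{s}$, projective spaces over $K$. The rings $S=K[t_1,\ldots,t_s]$ and $S[u]$, $u=t_{s+1}$, are polynomial rings with the standard grading. $I(X)$ (resp. $I(Y)$) is the ideal of $S$ (resp. $S[u]$) generated by the homogeneous polynomials that vanish on $X$ (resp. $Y$). *)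

(* Defs.v *)
From HB Require Import structures.
From mathcomp Require Import all_boot all_order all_algebra.
From mathcomp Require Import mpoly.

Set Implicit Arguments.
Unset Strict Implicit.
Unset Printing Implicit Defensive.

Import GRing.Theory.
Local Open Scope ring_scope.

(* Ideals are Prop-valued predicates: membership in an ideal generated by an
   arbitrary family is not decidable a priori, so the boolean [idealr] of
   ring_quotient does not apply. *)
Section Ideals.
Variable R : comNzRingType.

Definition ideal_gen (G : R -> Prop) (p : R) : Prop :=
  exists (m : nat) (a g : 'I_m -> R),
    (forall i, G (g i)) /\ p = \sum_(i < m) a i * g i.

Definition ideal_principal (g : R) : R -> Prop := ideal_gen (fun p => p = g).

Definition ideal_add (I J : R -> Prop) (p : R) : Prop :=
  exists a b, [/\ I a, J b & p = a + b].

Definition ideal_eq (I J : R -> Prop) : Prop := forall p, I p <-> J p.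

End Ideals.

(* [mwiden : S -> S[u]] sends t_i to t_i; the new variable u is 'X_ord_max. *)
Definition ideal_ext (R : comNzRingType) (n : nat) (I : {mpoly R[n]} -> Prop) :
  {mpoly R[n.+1]} -> Prop :=
  ideal_gen (fun p => exists2 g, I g & p = mwiden g).

Section Projective.
Variables (K : finFieldType) (n : nat).

(* A point of the projective space P^(n-1) over K is the class, under nonzero
   scaling, of a nonzero vector of K^n. *)
Definition proj_point (v : 'rV[K]_n) : {set 'rV[K]_n} :=
  [set c *: v | c : K & c != 0].

Definition vanishes_on (Z : {set {set 'rV[K]_n}}) (p : {mpoly K[n]}) : Prop :=
  forall P, P \in Z -> forall v : 'rV[K]_n, v \in P -> p.@[v 0] = 0.

Definition vanishing_ideal (Z : {set {set 'rV[K]_n}}) : {mpoly K[n]} -> Prop :=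
  ideal_gen (fun p => (exists d, p \is d.-homog) /\ vanishes_on Z p).

End Projective.

Definition is_clutter (V : finType) (E : {set {set V}}) : Prop :=
  {in E &, forall e1 e2 : {set V}, e1 \subset e2 -> e1 = e2}.

Section ClutterSets.
Variables (K : finFieldType) (V : finType).

Definition torus : {set {ffun V -> K}} := [set x : {ffun V -> K} | [forall j, x j != 0]].

Definition char_vec (e : {set V}) (j : V) : nat := j \in e.

Definition edge_monomial (x : {ffun V -> K}) (e : {set V}) : K :=
  \prod_(j : V) x j ^+ char_vec e j.

Variables (s : nat) (f : s.-tuple {set V}).

Definition param_vec (x : {ffun V -> K}) : 'rV[K]_s :=
  \row_i edge_monomial x (tnth f i).

(* Appends the coordinate 1 in the last position ord_max. *)
Definition param_vec1 (x : {ffun V -> K}) : 'rV[K]_s.+1 :=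
  \row_i (if unlift ord_max i is Some j then param_vec x 0 j else 1).

Definition toric_set : {set {set 'rV[K]_s}} :=
  [set proj_point (param_vec x) | x in torus].

Definition toric_set1 : {set {set 'rV[K]_s.+1}} :=
  [set proj_point (param_vec1 x) | x in torus].

End ClutterSets.

Arguments toric_set K {V s} f.
Arguments toric_set1 K {V s} f.

(* Main.v *)
Require Import Defs.
From HB Require Import structures.
From mathcomp Require Import all_boot all_order all_algebra.
From mathcomp Require Import finfield.
From mathcomp Require Import mpoly.

Set Implicit Arguments.
Unset Strict Implicit.
Unset Printing Implicit Defensive.

Import GRing.Theory.
Local Open Scope ring_scope.

(** Either hypothesis makes the set of vectors [(x^v_1, ..., x^v_s)] stable
    under scaling by [K^*]: in (a) scale the coordinates in [A], in (b) scale
    all coordinates by a [k]-th root, which exists as [k] is prime to [q - 1].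
    Modulo [t_1^(q-1) - u^(q-1)], a form [F] of degree [d] vanishing on [Y] is
    [\sum_(j < q - 1) G_j u^j] with [G_j] a form of degree [d - j] in [t].
    Evaluating at [(c y, 1)] and dividing by [c^d] shows that the polynomial
    [\sum_j G_j(y) T^j], of degree less than [q - 1], vanishes on all of [K^*];
    hence every [G_j] vanishes on [X]. *)

(** * Ideals as predicates, and ideals generated by a family *)

Section IdealTheory.
Variable R : comNzRingType.
Implicit Types (I J G : R -> Prop) (a p q : R).

Definition is_ideal I : Prop :=
  [/\ I 0, forall p q, I p -> I q -> I (p + q) & forall a p, I p -> I (a * p)].

Lemma is_ideal_sum I (T : eqType) (r : seq T) (P : pred T) (F : T -> R) :
    is_ideal I -> (forall i, i \in r -> P i -> I (F i)) ->
  I (\sum_(i <- r | P i) F i).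
Proof.
by case=> I0 ID _ IF; rewrite big_seq_cond; elim/big_ind: _ => // i /andP[/IF].
Qed.

Lemma mem_ideal_gen G p : G p -> ideal_gen G p.
Proof.
move=> Gp; exists 1%N, (fun=> 1), (fun=> p); split=> //.
by rewrite big_ord1 mul1r.
Qed.

Lemma is_ideal_gen G : is_ideal (ideal_gen G).
Proof.
split.
- by exists 0%N, (fun=> 0), (fun=> 0); split; [case | rewrite big_ord0].
- move=> p q [m [a [g [Gg ->]]]] [m' [a' [g' [Gg' ->]]]].
  pose glue (T : Type) (h : 'I_m -> T) (h' : 'I_m' -> T) (i : 'I_(m + m')) :=
    match split i with inl j => h j | inr j => h' j end.
  exists (m + m')%N, (glue _ a a'), (glue _ g g'); split.
    by move=> i; rewrite /glue; case: (split i).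
  rewrite big_split_ord; congr (_ + _); apply: eq_bigr => i _.
    by rewrite /glue; case: splitP => j /= E; rewrite ?(ord_inj E) //;
       have := ltn_ord i; rewrite E ltnNge leq_addr.
  rewrite /glue; case: splitP => j /= E.
    by have := ltn_ord j; rewrite -E ltnNge leq_addr.
  by move/addnI/ord_inj: E => ->.
- move=> b p [m [a [g [Gg ->]]]]; exists m, (fun i => b * a i), g; split=> //.
  by rewrite mulr_sumr; apply: eq_bigr => i _; rewrite mulrA.
Qed.

(** Used with [I] a kernel of evaluation or a preimage under [mwiden] as well, so that such claims
    too are checked on generators only. *)
Lemma ideal_gen_sub G I p :
  is_ideal I -> (forall g, G g -> I g) -> ideal_gen G p -> I p.
Proof.
move=> idI GI [m [a [g [Gg ->]]]]; apply: is_ideal_sum => // i _ _.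
by have [_ _] := idI; apply; apply: GI.
Qed.

Lemma is_ideal_add I J : is_ideal I -> is_ideal J -> is_ideal (ideal_add I J).
Proof.
move=> [I0 ID IM] [J0 JD JM]; split.
- by exists 0, 0; rewrite addr0.
- move=> _ _ [a [b [Ia Jb ->]]] [c [d [Ic Jd ->]]].
  by exists (a + c), (b + d); rewrite addrACA; split; auto.
- move=> c _ [a [b [Ia Jb ->]]].
  by exists (c * a), (c * b); rewrite mulrDr; split; auto.
Qed.

Lemma ideal_add_sub I J I' p :
    is_ideal I' -> (forall a, I a -> I' a) -> (forall b, J b -> I' b) ->
  ideal_add I J p -> I' p.
Proof. by move=> [_ D _] sI sJ [a [b [Ia Jb ->]]]; auto. Qed.

End IdealTheory.

(** * Powers, roots and polynomials over a finite field *)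

Lemma finField_expf1 (K : finFieldType) (c : K) : c != 0 -> c ^+ (#|K| - 1) = 1.
Proof.
move=> c0; apply: (mulfI c0); rewrite mulr1 -exprS subn1 prednK ?expf_card //.
exact: ltnW (card_finNzRing_gt1 K).
Qed.

(** Bezout gives [u * k = v * (#|K| - 1) + 1], so the [k]-th power of [c ^+ u] is [c]. *)
Lemma finField_root (K : finFieldType) (k : nat) (c : K) :
  (0 < k)%N -> coprime (#|K| - 1) k -> c != 0 -> exists b : K, b ^+ k = c.
Proof.
move=> k0 /eqP cop c0; case: (egcdnP (#|K| - 1) k0) => u v def_uk _.
exists (c ^+ u).
rewrite -exprM def_uk gcdnC cop exprD expr1 mulnC exprM.
by rewrite finField_expf1 // expr1n mul1r.
Qed.

Lemma finField_sum_eq0 (K : finFieldType) (a : 'I_(#|K| - 1) -> K) :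
    (forall c : K, c != 0 -> \sum_j a j * c ^+ j = 0) ->
  forall j, a j = 0.
Proof.
(* [E] extends [a] by zero to all natural indices, so that it can serve as the coefficients of a
   polynomial. *)
move=> a0 j; pose E i := if insub i is Some i' then a i' else 0.
pose p := \poly_(i < #|K| - 1) E i.
have aE (i : 'I_(#|K| - 1)) : E i = a i.
  by rewrite /E valK.
have p0 : p = 0.
  (* The size of [p] is at most [#|K| - 1], the number of its known roots. *)
  apply: (@roots_geq_poly_eq0 _ p (enum [pred c : K | c != 0])).
  - apply/allP => c; rewrite mem_enum inE => c0.
    rewrite /root horner_poly; apply/eqP; rewrite -[RHS](a0 c c0).
    by apply: eq_bigr => i _; rewrite aE.
  - exact: enum_uniq.
  - rewrite -cardE; apply: leq_trans (size_poly _ _) _.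
    by rewrite subn1 (cardC1 (0 : K)).
by have := coef_poly (#|K| - 1) E j; rewrite -/p p0 coef0 ltn_ord aE.
Qed.

(** * Passing between [S] and [S[u]] *)

Section Mpoly.
Variables (K : fieldType) (s : nat).
Implicit Types (m : 'X_{1..s.+1}) (p : {mpoly K[s]}).

Lemma widen_ord_lift (i : 'I_s) : widen_ord (leqnSn s) i = lift ord_max i.
Proof. by apply: val_inj; rewrite /= /bump leqNgt ltn_ord. Qed.

Lemma meval_mwiden (v : 'I_s.+1 -> K) p :
  (mwiden p).@[v] = p.@[fun i => v (lift ord_max i)].
Proof.
rewrite {1}[p]mpolyE (raddf_sum (@mwiden s K)) (raddf_sum (meval v)) mevalE.
apply: eq_bigr => m _ /=.
rewrite mwidenZ mwidenX mevalZ mevalX big_ord_recr /= mnmwiden_ordmax.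
rewrite expr0 mulr1; congr (_ * _); apply: eq_bigr => i _.
by rewrite mnmwiden_widen widen_ord_lift.
Qed.

Lemma meval_homogZ d n (p : {mpoly K[n]}) (c : K) (v : 'rV[K]_n) :
  p \is d.-homog -> p.@[(c *: v) 0] = c ^+ d * p.@[v 0].
Proof.
move=> /dhomogP hp; rewrite !mevalE mulr_sumr big_seq [RHS]big_seq.
apply: eq_bigr => m /hp <-.
rewrite mulrCA /= mdegE -prodrXr -big_split /=; congr (_ * _).
by apply: eq_bigr => i _; rewrite mxE exprMn.
Qed.

Lemma meval_ideal_principal n (g p : {mpoly K[n]}) (v : 'I_n -> K) :
  g.@[v] = 0 -> ideal_principal g p -> p.@[v] = 0.
Proof.
move=> gv; apply: (ideal_gen_sub (I := fun a : {mpoly K[n]} => a.@[v] = 0));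
  last by move=> _ ->.
split=> [|a b av bv|a b bv]; first exact: meval0.
  by rewrite mevalD av bv addr0.
by rewrite mevalM bv mulr0.
Qed.

Lemma mdeg_mnmwiden (m : 'X_{1..s}) : mdeg (mnmwiden m) = mdeg m.
Proof.
rewrite !mdegE big_ord_recr /= mnmwiden_ordmax addn0.
by apply: eq_bigr => i _; rewrite mnmwiden_widen.
Qed.

Lemma mwiden_homog d p : p \is d.-homog -> mwiden p \is d.-homog.
Proof.
move=> /dhomogP hp; rewrite [p]mpolyE (raddf_sum (@mwiden s K)) big_seq rpred_sum // => m /hp hm.
by rewrite /= mwidenZ mwidenX rpredZ // dhomogX /= mdeg_mnmwiden -hm.
Qed.

Definition mnmrestr m : 'X_{1..s} := [multinom m (lift ord_max i) | i < s].

Lemma mnmrestrE m :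
  m = (mnmwiden (mnmrestr m) + U_(ord_max) *+ m ord_max)%MM.
Proof.
apply/mnmP => i; rewrite mnmDE mulmnE mnm1E; case: (unliftP ord_max i) => [j|] ->.
  rewrite -widen_ord_lift mnmwiden_widen mnmE widen_ord_lift.
  by rewrite (negPf (neq_lift _ _)) addn0.
by rewrite mnmwiden_ordmax eqxx mul1n.
Qed.

Lemma mdeg_mnmrestr m : mdeg m = (mdeg (mnmrestr m) + m ord_max)%N.
Proof. by rewrite {1}[m]mnmrestrE mdegD mdegMn mdeg1 mul1n mdeg_mnmwiden. Qed.

(** * Division by [t_i0^N - u^N] *)

Section Reduction.
Variables (N : nat) (N0 : (0 < N)%N) (i0 : 'I_s).
Implicit Type F : {mpoly K[s.+1]}.

Definition red_exp m : 'I_N := Ordinal (ltn_pmod (m ord_max) N0).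

(** With [k] the quotient and [r] the remainder of the exponent of [u] by [N], the factor
    [u^(N * k)] becomes [t_i0^(N * k)], while [u^r] is recorded by [red_exp]. *)
Definition red_mnm m : 'X_{1..s} :=
  (mnmrestr m + U_(i0) *+ (N * (m ord_max %/ N)))%MM.

(* Coefficient of [u^j] once [u^N] has been replaced by [t_i0^N] in [F]. *)
Definition red_coef F (j : 'I_N) : {mpoly K[s]} :=
  \sum_(m <- msupp F | red_exp m == j) F@_m *: 'X_[red_mnm m].

(** Trading [u^(N * k)] for [t_i0^(N * k)] keeps the total degree; only the factor [u^j] is
    removed. *)
Lemma red_coef_homog d F j : F \is d.-homog -> red_coef F j \is (d - j).-homog.
Proof.
move=> /dhomogP hF; rewrite /red_coef big_seq_cond rpred_sum // => m.
case/andP=> /hF hm /eqP <-; rewrite rpredZ // dhomogX /red_mnm /=.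
rewrite mdegD mdegMn mdeg1 mul1n -hm /= mdeg_mnmrestr.
by rewrite {2}(divn_eq (m ord_max) N) addnA addnK mulnC.
Qed.

(* Needed because [d - j] in the previous lemma is truncated. *)
Lemma red_coef_eq0 d F (j : 'I_N) :
  F \is d.-homog -> (d < j)%N -> red_coef F j = 0.
Proof.
move=> /dhomogP hF ltdj; rewrite /red_coef big_seq_cond big1 // => m.
case/andP=> /hF hm /eqP jE; move: ltdj; rewrite -jE -hm /= ltnNge.
by rewrite mdeg_mnmrestr (leq_trans (leq_mod _ _)) ?leq_addl.
Qed.

(** Checked monomial by monomial. The separate index [w] allows a use with [ord0], which equals a
    lift only propositionally. *)
Lemma red_coefP F (w : 'I_s.+1) : w = lift ord_max i0 ->
  ideal_principal ('X_w ^+ N - 'X_ord_max ^+ N)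
    (F - \sum_(j < N) mwiden (red_coef F j) * 'X_ord_max ^+ j).
Proof.
move=> ->; rewrite -widen_ord_lift; set g := _ - _.
(* Regrouping by the remainder of the exponent of [u] turns the reduced form into one sum over the
   support of [F]. *)
have -> : \sum_(j < N) mwiden (red_coef F j) * 'X_ord_max ^+ j =
    \sum_(m <- msupp F) F@_m *: ('X_[mnmwiden (red_mnm m)] *
                                 'X_ord_max ^+ (red_exp m)).
  rewrite [RHS](partition_big red_exp xpredT) //=; apply: eq_bigr => j _.
  rewrite /red_coef raddf_sum mulr_suml; apply: eq_bigr => m /eqP <- /=.
  by rewrite mwidenZ mwidenX scalerAl.
rewrite {1}[F]mpolyE -sumrB; apply: is_ideal_sum => [|m _ _].
  exact: is_ideal_gen.
have [_ _ IM] := is_ideal_gen (fun a : {mpoly K[s.+1]} => a = g).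
set k := (m ord_max %/ N)%N.
have mE : 'X_[m] = 'X_[mnmwiden (mnmrestr m)] * 'X_ord_max ^+ m ord_max
    :> {mpoly K[s.+1]}.
  by rewrite {1}[m]mnmrestrE mpolyXD -mpolyXn.
have rE : 'X_[mnmwiden (red_mnm m)] = 'X_[mnmwiden (mnmrestr m)] *
    'X_(widen_ord (leqnSn s) i0) ^+ (N * k) :> {mpoly K[s.+1]}.
  rewrite -!mwidenX /red_mnm -/k mpolyXD mwidenM -mpolyXn rmorphXn /=.
  by rewrite (mwidenX _ U_(i0)) mnmwiden1.
rewrite -scalerBr -mul_mpolyC; apply: (IM).
have -> : 'X_[m] - 'X_[mnmwiden (red_mnm m)] * 'X_ord_max ^+ red_exp m =
    'X_[mnmwiden (mnmrestr m)] * 'X_ord_max ^+ red_exp m *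
    ('X_ord_max ^+ (N * k) - 'X_(widen_ord (leqnSn s) i0) ^+ (N * k))
    :> {mpoly K[s.+1]}.
  rewrite mE rE {1}(divn_eq (m ord_max) N) -/k mulrBr; congr (_ - _).
    by rewrite addnC (mulnC k) exprD mulrA.
  by rewrite mulrAC.
(* A difference of [k]-th powers of [t_i0^N] and [u^N] is a multiple of [g]. *)
apply: (IM); rewrite -opprB !exprM subrXX -/g mulrC -mulNr.
by apply: (IM); apply: mem_ideal_gen.
Qed.

End Reduction.
End Mpoly.

(** * Edge monomials on the torus and vanishing on [X] and [Y] *)

Section ClutterTheory.
Variables (K : finFieldType) (V : finType).
Implicit Types (x w : {ffun V -> K}) (e : {set V}).

Lemma edge_monomialE x e : edge_monomial x e = \prod_(j in e) x j.
Proof.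
rewrite /edge_monomial [RHS]big_mkcond; apply: eq_bigr => j _.
by rewrite /char_vec; case: (j \in e).
Qed.

Lemma edge_monomialM w x e :
  edge_monomial [ffun j => w j * x j] e = edge_monomial w e * edge_monomial x e.
Proof.
by rewrite !edge_monomialE -big_split; apply: eq_bigr => j _; rewrite ffunE.
Qed.

Lemma torus_neq0 x j : x \in torus K V -> x j != 0.
Proof. by rewrite inE => /forallP. Qed.

Lemma torusM w x :
  w \in torus K V -> x \in torus K V -> [ffun j => w j * x j] \in torus K V.
Proof.
move=> wT xT; rewrite inE; apply/forallP => j.
by rewrite ffunE mulf_neq0 // torus_neq0.
Qed.

Lemma edge_monomial_neq0 x e : x \in torus K V -> edge_monomial x e != 0.
Proof.
by move=> xT; rewrite edge_monomialE prodf_seq_neq0; apply/allP => j _;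
  rewrite torus_neq0 ?implybT.
Qed.

(** The single vertex of [e] in [A] contributes [c], every other vertex 1. *)
Lemma edge_monomial_transversal (A : {set V}) (c : K) e :
  #|A :&: e| = 1%N -> edge_monomial [ffun j => if j \in A then c else 1] e = c.
Proof.
move=> Ae; rewrite edge_monomialE -[RHS]expr1 -[in RHS]Ae -prodr_const.
under [RHS]eq_bigl do rewrite inE andbC.
by rewrite [RHS]big_mkcondr; apply: eq_bigr => j _; rewrite ffunE.
Qed.

Lemma edge_monomial_const (b : K) e : edge_monomial [ffun=> b] e = b ^+ #|e|.
Proof.
by rewrite edge_monomialE -prodr_const; apply: eq_bigr => j _; rewrite ffunE.
Qed.

Lemma vanishes_proj_point n d (p : {mpoly K[n]}) (v : 'rV[K]_n) :
    p \is d.-homog ->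
  (forall u, u \in proj_point v -> p.@[u 0] = 0) <-> p.@[v 0] = 0.
Proof.
move=> hp; split=> [|pv u /imsetP[c _ ->]]; last first.
  by rewrite (meval_homogZ _ _ hp) pv mulr0.
apply; apply/imsetP; exists 1; rewrite ?scale1r //.
by rewrite inE oner_neq0.
Qed.

Variables (s : nat) (f : s.-tuple {set V}).

Lemma vanishes_toric_set d (p : {mpoly K[s]}) : p \is d.-homog ->
  vanishes_on (toric_set K f) p <->
  (forall x, x \in torus K V -> p.@[param_vec f x 0] = 0).
Proof.
move=> hp; split=> [hZ x xT | hx P /imsetP[x xT ->]].
  apply/(vanishes_proj_point _ hp) => w; apply: hZ.
  exact: imset_f.
by apply/(vanishes_proj_point _ hp); apply: hx.
Qed.

Lemma vanishes_toric_set1 d (p : {mpoly K[s.+1]}) : p \is d.-homog ->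
  vanishes_on (toric_set1 K f) p <->
  (forall x, x \in torus K V -> p.@[param_vec1 f x 0] = 0).
Proof.
move=> hp; split=> [hZ x xT | hx P /imsetP[x xT ->]].
  apply/(vanishes_proj_point _ hp) => w; apply: hZ.
  exact: imset_f.
by apply/(vanishes_proj_point _ hp); apply: hx.
Qed.

Lemma param_vec1_lift x i : param_vec1 f x 0 (lift ord_max i) = param_vec f x 0 i.
Proof. by rewrite mxE liftK. Qed.

Lemma param_vec1_max x : param_vec1 f x 0 ord_max = 1.
Proof. by rewrite mxE unlift_none. Qed.

Lemma meval_param_vec1 x (p : {mpoly K[s]}) :
  (mwiden p).@[param_vec1 f x 0] = p.@[param_vec f x 0].
Proof. by rewrite meval_mwiden; apply: meval_eq => i; rewrite param_vec1_lift. Qed.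

(** The one property through which (a) and (b) enter: with [[y : 1]], also [[c y : 1]] lies in
    [Y]. *)
Definition scaling_stable : Prop := forall (c : K) x,
  c != 0 -> x \in torus K V ->
  exists2 x', x' \in torus K V & param_vec f x' = c *: param_vec f x.

Lemma scaling_stable_weight :
    (forall c : K, c != 0 -> exists2 w, w \in torus K V &
      forall e, e \in f -> edge_monomial w e = c) ->
  scaling_stable.
Proof.
move=> hw c x c0 xT; have [w wT wc] := hw c c0.
exists [ffun j => w j * x j]; first exact: torusM.
by apply/rowP => i; rewrite !mxE edge_monomialM wc ?mem_tnth.
Qed.

(** * The two inclusions between the ideals *)

Hypothesis hs : (0 < s)%N.

Let ext_ideal := ideal_add (ideal_ext (vanishing_ideal (toric_set K f)))
  (ideal_principal ('X_ord0 ^+ (#|K| - 1) - 'X_ord_max ^+ (#|K| - 1)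
    : {mpoly K[s.+1]})).

(** As [s] is positive, [ord0] indexes [t_1] and not [u]. *)
Let ord0_lift : ord0 = lift ord_max (Ordinal hs) :> 'I_s.+1.
Proof. by apply: val_inj; rewrite /= /bump leqNgt hs. Qed.

Lemma meval_binomial x : x \in torus K V ->
  ('X_ord0 ^+ (#|K| - 1) - 'X_ord_max ^+ (#|K| - 1)
    : {mpoly K[s.+1]}).@[param_vec1 f x 0] = 0.
Proof.
move=> xT; rewrite mevalB !rmorphXn /= !mevalXU param_vec1_max ord0_lift.
rewrite param_vec1_lift mxE finField_expf1 ?expr1n ?subrr //.
exact: edge_monomial_neq0.
Qed.

Lemma toric_set1_ideal_sub p :
  ext_ideal p -> vanishing_ideal (toric_set1 K f) p.
Proof.
have idY : is_ideal (vanishing_ideal (toric_set1 K f)) by apply: is_ideal_gen.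
apply: ideal_add_sub => // {p}.
  move=> p; apply: ideal_gen_sub => // _ [g Xg ->].
  have [Y0 YD YM] := idY.
  (* The preimage of [I(Y)] under [mwiden] is an ideal of [S], so forms vanishing on [X] suffice. *)
  apply: (ideal_gen_sub (I := fun a : {mpoly K[s]} =>
    vanishing_ideal (toric_set1 K f) (mwiden a)) _ _ Xg).
    split=> [|p1 p2 h1 h2|a p1 h1]; rewrite ?mwiden0 ?mwidenD ?mwidenM //.
      exact: YD.
    exact: YM.
  move=> h [[d hg] Xh]; apply: mem_ideal_gen; split.
    by exists d; apply: mwiden_homog.
  apply/(vanishes_toric_set1 (mwiden_homog hg)) => x xT.
  by rewrite meval_param_vec1; exact: (vanishes_toric_set hg).1 Xh x xT.
move=> p; apply: ideal_gen_sub => // _ ->; apply: mem_ideal_gen.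
have Xhomog (i : 'I_s.+1) :
    ('X_i ^+ (#|K| - 1) : {mpoly K[s.+1]}) \is (#|K| - 1).-homog.
  rewrite -[X in X.-homog]mul1n; apply: dhomogMn.
  by rewrite dhomogX /= mdeg1.
have hg : ('X_ord0 ^+ (#|K| - 1) - 'X_ord_max ^+ (#|K| - 1) : {mpoly K[s.+1]})
    \is (#|K| - 1).-homog by rewrite rpredB.
split; first by exists (#|K| - 1)%N.
exact/(vanishes_toric_set1 hg)/meval_binomial.
Qed.

Lemma toric_set1_ideal_sup p :
  scaling_stable -> vanishing_ideal (toric_set1 K f) p -> ext_ideal p.
Proof.
move=> stable; apply: ideal_gen_sub => [|F [[d hF] YF]].
  by apply: is_ideal_add; apply: is_ideal_gen.
have N0 : (0 < #|K| - 1)%N by rewrite subn_gt0 card_finNzRing_gt1.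
have hG j := red_coef_homog N0 (Ordinal hs) j hF.
have redF := red_coefP N0 F ord0_lift.
set G := red_coef N0 (Ordinal hs) F in hG redF.
(* The reduced form goes to the extension of [I(X)], the rest is a multiple of the binomial. *)
exists (\sum_j mwiden (G j) * 'X_ord_max ^+ j),
  (F - \sum_j mwiden (G j) * 'X_ord_max ^+ j); split=> //; last first.
  by rewrite addrC subrK.
have idX : is_ideal (ideal_ext (vanishing_ideal (toric_set K f))).
  exact: is_ideal_gen.
apply: is_ideal_sum => // j _ _; rewrite mulrC.
have [_ _] := idX; apply; apply: mem_ideal_gen; exists (G j) => //.
apply: mem_ideal_gen; split; first by exists (d - j)%N.
apply/(vanishes_toric_set (hG j)) => x xT.
apply: (finField_sum_eq0 (a := fun j => (G j).@[param_vec f x 0])) => c c0.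
(* Scaling by the inverse of [c] gives [G i] the factor [c^(i - d)]; multiplying by [c ^+ d] leaves
   the wanted [c ^+ i]. *)
have [x' x'T x'E] := stable _ _ (invr_neq0 c0) xT.
have := (vanishes_toric_set1 hF).1 YF _ x'T.
rewrite -[F in F.@[_]](subrK (\sum_j mwiden (G j) * 'X_ord_max ^+ j)) mevalD.
rewrite (meval_ideal_principal (meval_binomial x'T) redF) add0r.
rewrite (raddf_sum (meval _)) /= => Gx'.
rewrite -[RHS](mulr0 (c ^+ d)) -[in RHS]Gx' mulr_sumr; apply: eq_bigr => i _.
rewrite mevalM rmorphXn /= mevalXU param_vec1_max expr1n mulr1 meval_param_vec1.
rewrite x'E (meval_homogZ _ _ (hG i)) mulrC mulrA exprVn.
(* For [d < i] the truncated [d - i] would give the wrong power of [c], but there [G i] is zero. *)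
case: (leqP i d) => [le_id | lt_di]; last first.
  by rewrite /G (red_coef_eq0 _ _ hF lt_di) meval0 !mulr0.
have -> : c ^+ d = c ^+ (d - i) * c ^+ i by rewrite -exprD subnK.
by rewrite (mulrAC _ (c ^+ i)) mulfV ?mul1r // expf_neq0.
Qed.

Lemma toric_set1_idealE :
  scaling_stable -> ideal_eq (vanishing_ideal (toric_set1 K f)) ext_ideal.
Proof.
move=> stable p; split; first exact: toric_set1_ideal_sup.
exact: toric_set1_ideal_sub.
Qed.

End ClutterTheory.

Theorem theorem2p10 (K : finFieldType) (q : nat) (V : finType)
    (E : {set {set V}}) (s : nat) (f : s.-tuple {set V})
    (hq : #|K| = q) (hq2 : q <> 2%N)
    (hE : is_clutter E) (hs : (1 <= s)%N)
    (hf : uniq f) (hfE : E = [set:: f]) :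
  let IX := vanishing_ideal (toric_set K f) in
  let IY := vanishing_ideal (toric_set1 K f) in
  let RHS := ideal_add (ideal_ext IX)
               (ideal_principal
                  ('X_ord0 ^+ (q - 1) - 'X_ord_max ^+ (q - 1) : {mpoly K[s.+1]})) in
  ((exists A : {set V}, forall e, e \in E -> #|A :&: e| = 1%N) ->
     ideal_eq IY RHS)
  /\
  (forall k : nat, (2 <= k)%N -> (forall e, e \in E -> #|e| = k) ->
     (gcdn (q - 1) k = 1)%N ->
     ideal_eq IY RHS).
Proof.
rewrite -hq /=.
have memE e : e \in f -> e \in E by rewrite hfE inE.
split=> [[A hA] | k k2 hk /eqP cop]; apply: toric_set1_idealE => //;
  apply: scaling_stable_weight => c c0.
(* Case (a): weight [c] on [A] and 1 elsewhere. *)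
- exists [ffun j => if j \in A then c else 1].
    by rewrite inE; apply/forallP => j; rewrite ffunE; case: ifP; rewrite ?oner_neq0.
  by move=> e /memE /hA; apply: edge_monomial_transversal.
(* Case (b): the constant weight [b] with [b ^+ k = c], nonzero because [c] is. *)
- have [b bE] := finField_root (ltnW k2) cop c0.
  exists [ffun=> b]; last by move=> e /memE /hk ek; rewrite edge_monomial_const ek.
  rewrite inE; apply/forallP => j; rewrite ffunE; apply: contra_neq c0 => b0.
  by rewrite -bE b0 expr0n gtn_eqF // ltnW.
Qed.
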